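(* Let $n$ and $k$ be integers with $3\leq k\leq n$. For every connected graph $G$ of order $n$, $$1\leq \kappa_k(G)\leq n-\lceil k/2\rceil.$$ Moreover, the upper and lower bounds are tight: there is a connected graph of order $n$ attaining the upper bound, and there is a connected graph of order $n$ attaining the lower bound.
   Context: All graphs are undirected, finite and simple. For a graph $G$ and a set $S\subseteq V(G)$ of at least two vertices, a tree connecting $S$ is a subgraph $T$ of $G$ that is a tree with $S\subseteq V(T)$. Two trees $T,T'$ connecting $S$ are internally disjoint if $E(T)\cap E(T')=\varnothing$ and $V(T)\cap V(T')=S$. Let $\kappa(S)$ be the maximum number of pairwise internally disjoint trees connecting $S$ in $G$. The generalized $k$-connectivity of $G$ is $\kappa_k(G)=\min\{\kappa(S) : S\subseteq V(G),\ |S|=k\}$. *)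

(* Defs.v *)
From mathcomp Require Import all_boot.
Set Implicit Arguments.
Unset Strict Implicit.
Unset Printing Implicit Defensive.

Record sgraph := SGraph {
  vertex :> finType;
  adj : rel vertex;
  adj_sym : symmetric adj;
  adj_irrefl : irreflexive adj }.

Arguments adj {s} _ _ : rename.

Section Relations.
Variable T : finType.
Implicit Types (V : {set T}) (r : rel T).

(* [V] is a vertex set containing the endpoints of all edges of [r]. *)
Definition connected_rel V r : bool :=
  (V != set0) && [forall x in V, forall y in V, connect r x y].

(* Cycles have at least three, pairwise distinct, vertices; bounding their
   length by #|T| makes the predicate boolean and loses nothing (acyclicP). *)
Definition acyclic r : bool :=
  [forall s : #|T|.-bseq T, (2 < size s) ==> ~~ ucycleb r s].

Lemma acyclicP r :
  reflect (forall s : seq T, 2 < size s -> ~ ucycle r s) (acyclic r).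
Proof.
apply: (iffP forallP) => [H s s2 cs | H s].
  have sz : size s <= #|T| by case/andP: cs => _ /card_uniqP <-; exact: max_card.
  by move: (H (Bseq sz)); rewrite /= s2 /= => /negP; apply.
by apply/implyP => s2; apply/negP => cs; exact: (H s s2).
Qed.

End Relations.

Section Graphs.
Variable G : sgraph.

Definition connected_graph : bool := connected_rel [set: G] adj.

Definition edges : {set {set G}} := [set [set x; y] | x in G, y in G & adj x y].

(* A pair (vertex set, edge set), edges being unordered pairs. *)
Definition subgraph : finType := ({set G} * {set {set G}})%type.
Implicit Types (S : {set G}) (H : subgraph).

Definition is_subgraph H : bool :=
  H.2 \subset [set e in edges | e \subset H.1].

Definition subgraph_adj H : rel G := [rel x y | [set x; y] \in H.2].

Definition is_tree H : bool :=
  connected_rel H.1 (subgraph_adj H) && acyclic (subgraph_adj H).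

Definition tree_connecting S H : bool :=
  [&& is_subgraph H, is_tree H & S \subset H.1].

Definition internally_disjoint S H H' : bool :=
  (H.2 :&: H'.2 == set0) && (H.1 :&: H'.1 == S).

Definition disjoint_trees S (F : {set subgraph}) : bool :=
  [forall H in F, tree_connecting S H] &&
  [forall H in F, [forall H' in F, (H != H') ==> internally_disjoint S H H']].

(* Counting sets rather than lists of trees is harmless: a tree connecting at
   least two vertices has an edge, so it is not internally disjoint from
   itself. *)
Definition kappa S : nat :=
  \max_(F : {set subgraph} | disjoint_trees S F) #|F|.

(* The neutral element given to [minn] is at least every [kappa S], so that
   this is the minimum as soon as k <= #|G| (see gen_connectivity_min). *)
Definition gen_connectivity (k : nat) : nat :=
  \big[minn/ \max_(S : {set G}) kappa S]_(S : {set G} | #|S| == k) kappa S.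

Lemma gen_connectivity_le k S : #|S| = k -> gen_connectivity k <= kappa S.
Proof.
move=> /eqP Sk; rewrite /gen_connectivity; move: (\max_(A : {set G}) _) => m.
have : S \in index_enum {set G} by rewrite mem_index_enum.
elim: (index_enum _) => // A r IH; rewrite inE big_cons => /orP[/eqP<-|/IH le].
  by rewrite Sk geq_minl.
by case: ifP => // _; rewrite geq_min le orbT.
Qed.

Lemma gen_connectivity_min k : k <= #|G| ->
  exists2 S : {set G}, #|S| = k & gen_connectivity k = kappa S.
Proof.
move=> kG.
have [S0 S0k] : exists S : {set G}, #|S| = k.
  exists [set x in take k (enum G)]; rewrite cardsE.
  by rewrite (card_uniqP (take_uniq _ (enum_uniq _))) size_takel // -cardE.
pose m := \max_(S : {set G}) kappa S.
have [e|//] : gen_connectivity k = m \/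
    exists2 S : {set G}, #|S| = k & gen_connectivity k = kappa S.
  rewrite /gen_connectivity -/m; elim/big_ind: _ => [|a b Ha Hb|S /eqP Sk].
  - by left.
  - by rewrite /minn; case: ifP.
  - by right; exists S.
exists S0 => //; apply/eqP; rewrite eqn_leq gen_connectivity_le //=.
by rewrite e /m (bigD1 S0) //= leq_maxl.
Qed.

End Graphs.

(* Main.v *)
(* Let [S] have [k] vertices. Of pairwise internally disjoint trees connecting
   [S], those with a vertex outside [S] own disjoint nonempty parts of the
   complement, so there are at most [n - k] of them; the others are
   edge-disjoint and use at least [k - 1] of the [k (k - 1) / 2] pairs in [S]
   each, so there are at most [k / 2] of them.  In the complete graph both
   counts are attained: a star with centre [v] for every [v] outside [S], and
   [k / 2] edge-disjoint double stars spanning [S].  In a star graph, every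
   tree connecting [S] uses the only edge at a given leaf in [S]. *)
Require Import Defs.
From mathcomp Require Import all_boot.
From mathcomp Require Import zify.

Set Implicit Arguments.
Unset Strict Implicit.
Unset Printing Implicit Defensive.

(** * Unordered pairs and double counting *)

Lemma set2_inj (T : finType) (a b c d : T) :
  [set a; b] = [set c; d] -> a = c /\ b = d \/ a = d /\ b = c.
Proof.
move=> E; have mem x : (x \in [set a; b]) = (x \in [set c; d]) by rewrite E.
move: (mem a) (mem b) (mem c) (mem d); rewrite !inE !eqxx !orbT /=.
by move=> /esym/pred2P[]? /esym/pred2P[]? /pred2P[]? /pred2P[]?; subst; auto.
Qed.

(** Count the pairs [(i, x)] with [x \in f i] twice: each [i] lies in at least [m] of them, each [x]
    of [D] in at most one. *)
Lemma leq_card_disjoint (I T : finType) (F : {set I}) (f : I -> {set T})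
    (D : {set T}) (m : nat) :
  {in F, forall i, f i \subset D} -> {in F, forall i, m <= #|f i|} ->
  {in F &, forall i j, i != j -> f i :&: f j = set0} -> #|F| * m <= #|D|.
Proof.
move=> fD fm fI; rewrite -sum_nat_const.
apply: (@leq_trans (\sum_(i in F) \sum_(x in D | x \in f i) 1)).
  apply: leq_sum => i iF; apply: leq_trans (fm i iF) _.
  rewrite -sum1_card eq_leq //; apply: eq_bigl => x.
  by case: (boolP (x \in f i)) => [/(subsetP (fD i iF))->|]; rewrite ?andbF.
rewrite (exchange_big_dep (mem D)) /=; last by move=> i x _ /andP[].
rewrite -sum1_card; apply: leq_sum => x xD.
rewrite sum1_card; apply/card_le1_eqP.
move=> i j /andP[iF /andP[_ xi]] /andP[jF /andP[_ xj]].
apply/eqP/contraT => ij.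
by have := in_set0 x; rewrite -(fI j i jF iF ij) inE xi xj.
Qed.

(** * Rooted trees encoded by parent functions *)

Section ParentFunctions.
Variable T : finType.
Implicit Types (V : {set T}) (r x y : T) (p : T -> T) (d : T -> nat).

Definition parent_edges V r p : {set {set T}} :=
  [set [set x; p x] | x in V :\ r].

(** The rank [d] certifies well-foundedness: following [p] must end at the root, and no cycle can
    close up. It need not be the depth. *)
Definition parent_function V r p d : Prop :=
  {in V :\ r, forall x, d (p x) < d x}.

(** Two vertices can only give the same edge if each is the parent of the other, and then the rank
    would drop in both directions. *)
Lemma card_parent_edges V r p d : r \in V ->
  parent_function V r p d -> #|parent_edges V r p| = #|V|.-1.
Proof.
move=> rV pP; rewrite card_in_imset; first by rewrite (cardsD1 r V) rV.
move=> x y xV yV /set2_inj[[]//|[xy yx]].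
by move: (pP x xV) (pP y yV); rewrite -xy yx => h; rewrite ltnNge ltnW.
Qed.

Lemma connected_parent_edges V r p d : r \in V ->
  parent_function V r p d -> {in V :\ r, forall x, p x \in V} ->
  connected_rel V [rel x y | [set x; y] \in parent_edges V r p].
Proof.
set e := [rel x y | _] => rV pP pV.
have esym : symmetric e by move=> x y; rewrite /e /= setUC.
have to_root x : x \in V -> connect e x r.
  elim: (d x).+1 {-2}x (ltnSn (d x)) => // n IH {}x dx xV.
  have [->|xr] := eqVneq x r; first exact: connect0.
  have xVr : x \in V :\ r by rewrite !inE xr.
  apply: (connect_trans (y := p x)); first by apply/connect1/imset_f.
  by apply: IH (pV _ xVr); apply: leq_trans (pP _ xVr) _.
apply/andP; split; first by apply/set0Pn; exists r.
apply/forall_inP => x xV; apply/forall_inP => y yV.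
apply: connect_trans (to_root x xV) _.
by rewrite (sym_connect_sym esym) to_root.
Qed.

Lemma acyclic_parent_edges V r p d : parent_function V r p d ->
  acyclic [rel x y | [set x; y] \in parent_edges V r p].
Proof.
set e := [rel x y | _] => pP.
apply/acyclicP => s s2 /andP[cs us].
have [x0 x0s] : exists x, x \in s.
  by case: s s2 {cs us} => // x s _; exists x; rewrite mem_head.
(* Both neighbours on the cycle of a vertex of maximal rank are its parent. *)
case: (arg_maxnP d x0s) => x xs xmax.
have up y : y \in s -> e x y -> y = p x.
  move=> ys /imsetP[w wV /set2_inj[[-> ->]//|[xw yw]]].
  by have := pP w wV; rewrite -xw -yw ltnNge => /negP[]; apply: xmax.
have [i s' rs] := rot_to xs.
move: cs us s2; rewrite -(rot_cycle i) -(rot_uniq i) -(size_rot i) rs.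
have sub y : y \in s' -> y \in s.
  by move=> ys; rewrite -(mem_rot i) rs inE ys orbT.
case: s' rs sub => [|y [|z s']] //= rs sub /andP[xy]; rewrite rcons_path /=.
case/and3P=> _ _ lx /and3P[_ + _] _; case/negP.
rewrite (up y _ xy) ?sub ?mem_head // -(up (last z s')) ?mem_last //.
  by rewrite sub // inE mem_last orbT.
by rewrite /e /= setUC.
Qed.

Lemma disjoint_parent_edges V V' r r' p p' :
  {in V :\ r & V' :\ r', forall x y, [set x; p x] <> [set y; p' y]} ->
  parent_edges V r p :&: parent_edges V' r' p' = set0.
Proof.
move=> ne; apply/setP => e; rewrite !inE; apply/andP => -[].
by case/imsetP=> x xV -> /imsetP[y yV /ne]; apply.
Qed.

(** A breadth-first tree: [d] is the distance from [r], and [p] picks a neighbour closer to [r]. *)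
Lemma connected_parent_function V r (e : rel T) :
  connected_rel V e -> symmetric e -> r \in V ->
  exists p d, parent_function V r p d /\ {in V :\ r, forall x, e x (p x)}.
Proof.
move=> /andP[_ /forall_inP cV] esym rV.
pose walk x n := [exists t : n.-tuple T, path e r t && (last r t == x)].
have walkP x s : path e r s -> last r s = x -> walk x (size s).
  by move=> es ls; apply/existsP; exists (in_tuple s); rewrite es ls eqxx.
(* Minimality is claimed outside [V] too, because the predecessor on a shortest walk is not known to
   lie in [V]; there the default 0 satisfies it. *)
have dist x : {n | (x \in V -> walk x n) /\ forall m, walk x m -> n <= m}.
  have [xV|xV] := boolP (x \in V); last by exists 0.
  have ex : exists n, walk x n.
    have /connectP[s es ls] := forall_inP (cV r rV) x xV.
    by exists (size s); apply: walkP.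
  by case: (ex_minnP ex) => n wn nmin; exists n.
pose d x := sval (dist x).
pose p x := odflt x [pick y | e x y && (d y < d x)].
have pP x : x \in V :\ r -> e x (p x) && (d (p x) < d x).
  rewrite !inE => /andP[xr xV]; rewrite /p; case: pickP => //= none.
  (* The last vertex but one of a shortest walk to [x] is a closer neighbour, so the choice in [p]
     cannot fail. *)
  have /existsP[t /andP[et /eqP lt]] := (svalP (dist x)).1 xV.
  have tsz := size_tuple t; move: et lt tsz; rewrite -/(d x).
  case/lastP: {t}(tval t) => [_ /= rx|s y]; first by rewrite rx eqxx in xr.
  rewrite rcons_path last_rcons size_rcons => /andP[es ey] yx sd.
  rewrite {}yx in ey; have := none (last r s); rewrite esym ey /=.
  by rewrite -sd ltnS (svalP (dist (last r s))).2 // walkP.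
by exists p, d; split=> x /pP/andP[].
Qed.

End ParentFunctions.

Lemma connected_rel_neighbour (T : finType) (V : {set T}) (e : rel T) (x : T) :
  connected_rel V e -> 1 < #|V| -> x \in V -> exists y, e x y.
Proof.
move=> /andP[_ /forall_inP cV] V2 xV.
have /card_gt0P[y] : 0 < #|V :\ x| by move: V2; rewrite (cardsD1 x) xV.
rewrite !inE => /andP[yx yV].
have /connectP[[|z s] /= es ls] := forall_inP (cV x xV) y yV.
  by rewrite ls eqxx in yx.
by exists z; case/andP: es.
Qed.

(** * Trees connecting a set, and general bounds on [kappa] *)

Section Graphs.
Variable G : sgraph.
Implicit Types (S : {set G}) (H : subgraph G) (F : {set subgraph G}).

Lemma in_edges (x y : G) : ([set x; y] \in edges G) = adj x y.
Proof.
apply/imset2P/idP => [[u v _ + /set2_inj[][-> ->]]|xy].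
- by rewrite inE => /andP[].
- by rewrite inE adj_sym => /andP[].
- by exists x y; rewrite ?inE.
Qed.

Lemma tree_edge_pair S H (e : {set G}) :
  tree_connecting S H -> e \in H.2 ->
  [/\ e \in edges G, e \subset H.1 & #|e| = 2].
Proof.
case/and3P=> /subsetP sH _ _ /sH; rewrite inE => /andP[eG eH].
split=> //; case/imset2P: eG => x y _; rewrite inE => /andP[_ xy] ->.
by rewrite cards2; have [xE|//] := eqVneq x y; rewrite xE adj_irrefl in xy.
Qed.

Lemma tree_neighbour S H x : 1 < #|S| -> tree_connecting S H -> x \in S ->
  exists y, [set x; y] \in H.2.
Proof.
move=> S2 /and3P[_ /andP[cH _] SH] xS.
apply: (connected_rel_neighbour cH); last exact: subsetP xS.
exact: leq_trans S2 (subset_leq_card SH).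
Qed.

(** A breadth-first tree inside [H] already has this many edges. *)
Lemma leq_card_tree_edges S H : tree_connecting S H -> #|H.1|.-1 <= #|H.2|.
Proof.
case/and3P=> _ /andP[cH _] _.
have [/set0Pn[r rH] _] := andP cH.
have sym : symmetric (subgraph_adj H).
  by move=> x y; rewrite /subgraph_adj /= setUC.
have [p [d [pP pE]]] := connected_parent_function cH sym rH.
rewrite -(card_parent_edges rH pP); apply: subset_leq_card.
by apply/subsetP => _ /imsetP[x xH ->]; apply: pE.
Qed.

Lemma parent_tree_connecting S (V : {set G}) r p d :
  S \subset V -> r \in V -> parent_function V r p d ->
  {in V :\ r, forall x, p x \in V} -> {in V :\ r, forall x, adj x (p x)} ->
  tree_connecting S (V, parent_edges V r p).
Proof.
move=> SV rV pP pV pA; apply/and3P; split=> //.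
  apply/subsetP => _ /imsetP[x xV ->]; rewrite inE in_edges pA //=.
  by rewrite subUset !sub1set pV // andbT; case/setD1P: xV.
apply/andP; split; first exact: connected_parent_edges pP pV.
exact: acyclic_parent_edges pP.
Qed.

Lemma disjoint_trees_kappa S F : disjoint_trees S F -> #|F| <= kappa S.
Proof. by move=> dF; rewrite /kappa (bigD1 F) //= leq_maxl. Qed.

(** Since [kappa] counts sets of trees, [f] must be injective: two equal members with distinct
    indices would share no edge with themselves, yet a tree connecting two vertices has an edge. *)
Lemma kappa_family (I : finType) (f : I -> subgraph G) S :
  1 < #|S| -> (forall i, tree_connecting S (f i)) ->
  (forall i j, i != j -> internally_disjoint S (f i) (f j)) -> #|I| <= kappa S.
Proof.
move=> S2 fT fD.
have f_inj : injective f.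
  move=> i j fij; apply/eqP/contraT => /fD/andP[/eqP + _].
  rewrite fij setIid => E0; have /card_gt0P[x xS] := ltnW S2.
  by have [y] := tree_neighbour S2 (fT j) xS; rewrite E0 inE.
rewrite -(card_imset _ f_inj); apply: disjoint_trees_kappa.
apply/andP; split; first by apply/forall_inP => _ /imsetP[i _ ->].
apply/forall_inP => _ /imsetP[i _ ->]; apply/forall_inP => _ /imsetP[j _ ->].
by apply/implyP => fij; apply: fD; apply: contraNneq fij => ->.
Qed.

Lemma kappa_gt0 S : connected_graph G -> 1 < #|S| -> 0 < kappa S.
Proof.
move=> cG S2; have /card_gt0P[r _] := ltnW S2.
have [p [d [pP pA]]] := connected_parent_function cG (@adj_sym G) (in_setT r).
(* A single spanning tree, as a family indexed by [unit], for which disjointness is vacuous. *)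
rewrite -card_unit.
apply: (kappa_family (f := fun=> (setT, parent_edges setT r p))) => // _.
by apply: parent_tree_connecting pP _ _ => // x _; rewrite inE.
Qed.

Lemma kappa_le S : 1 < #|S| -> kappa S <= #|G| - #|S| + #|S|./2.
Proof.
move=> S2; apply/bigmax_leqP => F /andP[/forall_inP FT /forall_inP FD].
have FI : {in F &, forall H H',
    H != H' -> H.2 :&: H'.2 = set0 /\ H.1 :&: H'.1 = S}.
  move=> H H' HF HF' nH.
  by have /implyP/(_ nH)/andP[/eqP ? /eqP] := forall_inP (FD H HF) H' HF'.
pose P := [pred H : subgraph G | H.1 == S].
rewrite -(cardsID [set H | P H]) addnC; apply: leq_add.
  have <- : #|~: S| = #|G| - #|S| by rewrite cardsCs setCK.
  rewrite -[leqLHS]muln1.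
  apply: (@leq_card_disjoint _ _ _ (fun H => H.1 :\: S)) => [H _|H|H H'].
  - by rewrite setDE subsetIr.
  - rewrite !inE => /andP[HS HF]; rewrite card_gt0 setD_eq0.
    have /and3P[_ _ SH] := FT H HF.
    by apply: contra HS; rewrite eqEsubset SH andbT.
  - rewrite !inE => /andP[_ HF] /andP[_ HF'] nH.
    by rewrite -setDIl (FI H H' HF HF' nH).2 setDv.
have : #|F :&: [set H | P H]| * #|S|.-1 <= 'C(#|S|, 2).
  rewrite -cards_draws.
  apply: (@leq_card_disjoint _ _ _ (fun H => H.2)) => [H|H|H H'].
  - rewrite !inE => /andP[HF /eqP HS].
    apply/subsetP => e /(tree_edge_pair (FT H HF)).
    by rewrite HS inE => -[_ -> ->].
  - rewrite !inE => /andP[HF /eqP HS].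
    by rewrite -HS; apply: leq_card_tree_edges (FT H HF).
  - by rewrite !inE => /andP[HF _] /andP[HF' _] nH; case: (FI H H' HF HF' nH).
(* Cancelling the positive factor [#|S|.-1] leaves at most [#|S|./2] trees with vertex set [S]. *)
by rewrite bin2; case: #|S| S2 => [|[|m]] //= _; nia.
Qed.

End Graphs.

(** * The complete graph, which attains the upper bound *)

Section CompleteGraph.
Variable n : nat.

Definition complete_adj : rel 'I_n := [rel x y | x != y].

Fact complete_adj_sym : symmetric complete_adj.
Proof. by move=> x y; rewrite /complete_adj /= eq_sym. Qed.

Fact complete_adj_irrefl : irreflexive complete_adj.
Proof. by move=> x; rewrite /complete_adj /= eqxx. Qed.

Definition complete_graph : sgraph :=
  SGraph complete_adj_sym complete_adj_irrefl.

Lemma complete_graph_connected : 0 < n -> connected_graph complete_graph.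
Proof.
move=> n0; apply/andP; split; first by apply/set0Pn; exists (Ordinal n0).
apply/forall_inP => x _; apply/forall_inP => y _.
by have [->|xy] := eqVneq x y; [apply: connect0 | apply: connect1].
Qed.

End CompleteGraph.

(* The [i]-th double star on the vertices [0, ..., k - 1], for [m = k./2] and
   [i < m], has root [i] and second centre [i + m].  The four edges between
   [{i, i + m}] and [{j, j + m}] are shared out: two to the [i]-th star, two to
   the [j]-th.  If [k] is odd, the vertex [2 m] is a leaf of every star. *)
Definition double_star_parent (m i a : nat) : nat :=
  if a < m then (if i < a then i else i + m)
  else (if i + m < a then i + m else i).

(** All leaves get 2, even those hanging from the root: only the strict decrease towards the root
    matters. *)
Definition double_star_rank (m i a : nat) : nat :=
  if a == i then 0 else if a == i + m then 1 else 2.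

Lemma double_star_parent_rank m i a : i < m -> a != i ->
  double_star_rank m i (double_star_parent m i a) < double_star_rank m i a.
Proof.
by rewrite /double_star_rank /double_star_parent; repeat (case: ifP; try lia).
Qed.

Lemma double_star_parent_lt m i a : i < m -> double_star_parent m i a < m.*2.
Proof. by rewrite /double_star_parent; repeat (case: ifP; try lia). Qed.

(** Two stars could share an edge with the same child in both, excluded here, or with child and
    parent exchanged, excluded by [double_star_parent_swap]. *)
Lemma double_star_parent_inj m i j a : i < m -> j < m ->
  double_star_parent m i a = double_star_parent m j a -> i = j.
Proof. by rewrite /double_star_parent; repeat (case: ifP; try lia). Qed.

(** Here [a] is a centre of star [j] and [b] a centre of star [i]. In each of the four cases the two
    equations ask for opposite inequalities between [i] and [j]. *)
Lemma double_star_parent_swap m i j a b : i < m -> j < m ->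
  a != i -> b != j ->
  a = double_star_parent m j b -> b = double_star_parent m i a -> i = j.
Proof. by rewrite /double_star_parent; repeat (case: ifP; try lia). Qed.

Lemma kappa_complete_graph n (S : {set complete_graph n}) : 1 < #|S| ->
  n - #|S| + #|S|./2 <= kappa S.
Proof.
move=> S2; pose m := #|S|./2.
have /card_gt0P[x0 x0S] := ltnW S2.
(* The vertices of [S] are numbered to carry the double stars. As the default [x0] is in [S], [vtx]
   lands in [S] even for indices out of range. *)
pose vtx a := nth x0 (enum S) a; pose idx x := index x (enum S).
have vtxS a : vtx a \in S.
  rewrite /vtx; have [aS|aS] := ltnP a (size (enum S)).
    by rewrite -mem_enum mem_nth.
  by rewrite nth_default.
have idxK x : x \in S -> vtx (idx x) = x.
  by move=> xS; rewrite /vtx nth_index ?mem_enum.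
have vtxK a : a < #|S| -> idx (vtx a) = a.
  by move=> aS; rewrite /idx index_uniq ?enum_uniq // -cardE.
have m2 : m.*2 <= #|S| by rewrite /m; lia.
have parS i a : i < m -> double_star_parent m i a < #|S|.
  by move=> im; apply: leq_trans (double_star_parent_lt a im) m2.
pose p i x : complete_graph n := vtx (double_star_parent m i (idx x)).
have idx_p i x : i < m -> idx (p i x) = double_star_parent m i (idx x).
  by move=> im; rewrite vtxK ?parS.
have idx_neq i x : i < m -> x \in S :\ vtx i -> idx x != i.
  by move=> im /setD1P[xi xS]; apply: contra xi => /eqP<-; rewrite idxK.
pose I := ('I_m + {x : complete_graph n | x \notin S})%type.
pose f (i : I) : subgraph (complete_graph n) := match i with
  | inl i => (S, parent_edges S (vtx i) (p i))
  | inr v => (sval v |: S, parent_edges (sval v |: S) (sval v) (fun=> sval v))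
  end.
have -> : n - #|S| + m = #|{: I}|.
  rewrite card_sum card_ord card_sig addnC; congr (_ + _).
  have <- : #|~: S| = n - #|S| by rewrite cardsCs setCK card_ord.
  by apply: eq_card => x; rewrite !inE.
apply: (@kappa_family _ _ f _ S2) => [[i|[v vS]]|].
- have rk x : x \in S :\ vtx i ->
      double_star_rank m i (idx (p i x)) < double_star_rank m i (idx x).
    by move=> xS; rewrite idx_p // double_star_parent_rank // idx_neq.
  apply: (@parent_tree_connecting _ _ _ _ _ (double_star_rank m i \o idx)) => //.
    by move=> x _; apply: vtxS.
  (* A strict drop in rank gives [p i x != x], which is adjacency in the complete graph. *)
  move=> x /rk; rewrite /= /complete_adj /=; apply: contraTneq => <-.
  by rewrite ltnn.
- have adjv x : x \in (v |: S) :\ v -> x != v by case/setD1P.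
  (* The boolean, read as a number, is the rank: 0 at the centre [v], 1 at the leaves. *)
  apply: (@parent_tree_connecting _ _ _ _ _ (fun x => x != v)) => /=.
  + exact: subsetUr.
  + exact: setU11.
  + by move=> x /adjv ->; rewrite eqxx.
  + by move=> x _; apply: setU11.
  + by [].
have starE v x : x \in (v |: S) :\ v -> x \in S.
  by rewrite !inE; case: (x == v).
(* Every edge of the star contains [v], whereas the edges of a double star stay inside [S]. *)
have mixed (i : 'I_m) v : v \notin S ->
    parent_edges S (vtx i) (p i) :&: parent_edges (v |: S) v (fun=> v) = set0.
  move=> vS; apply: disjoint_parent_edges.
  move=> x y /setD1P[_ xS] _ /set2_inj[[_ E]|[E _]].
    by rewrite -E vtxS in vS.
  by rewrite -E xS in vS.
case=> [i|[v vS]] [j|[w wS]] ij; apply/andP; rewrite /=; split; apply/eqP.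
- apply: disjoint_parent_edges => x y xS yS E; case/eqP: ij; congr inl.
  have [xi yj] := (idx_neq i x (ltn_ord i) xS, idx_neq j y (ltn_ord j) yS).
  apply: ord_inj; case: (set2_inj E) => -[xy /(congr1 idx)].
    rewrite !idx_p // xy; exact: double_star_parent_inj.
  move/(congr1 idx): xy; rewrite !idx_p // => xy /esym.
  exact: double_star_parent_swap xy.
- exact: setIid.
- exact: mixed.
- by apply/setIidPl; apply: subsetUr.
- by rewrite setIC mixed.
- by apply/setIidPr; apply: subsetUr.
- apply: disjoint_parent_edges => x y /starE xS _ /set2_inj[[_ vw]|[xw _]].
    by case/eqP: ij; congr inr; apply: val_inj.
  by case/negP: (wS); rewrite -xw.
- rewrite -setUIl; apply/setUidPr/subsetP => x.
  rewrite !inE => /andP[/eqP-> /eqP vw].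
  by case/eqP: ij; congr inr; apply: val_inj.
Qed.

(** * The star graph, which attains the lower bound *)

Section StarGraph.
Variable n : nat.

Definition star_adj : rel 'I_n :=
  [rel x y : 'I_n | (x != y) && ((x == 0 :> nat) || (y == 0 :> nat))].

Fact star_adj_sym : symmetric star_adj.
Proof. by move=> x y; rewrite /star_adj /= eq_sym orbC. Qed.

Fact star_adj_irrefl : irreflexive star_adj.
Proof. by move=> x; rewrite /star_adj /= eqxx. Qed.

Definition star_graph : sgraph := SGraph star_adj_sym star_adj_irrefl.

Lemma star_graph_connected : 0 < n -> connected_graph star_graph.
Proof.
move=> n0; pose c : star_graph := Ordinal n0.
have to_c (x : star_graph) : connect adj x c.
  have [->|xc] := eqVneq x c; first exact: connect0.
  by apply: connect1; rewrite /= /star_adj /= xc orbT.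
apply/andP; split; first by apply/set0Pn; exists c.
apply/forall_inP => x _; apply/forall_inP => y _.
apply: connect_trans (to_c x) _.
by rewrite (sym_connect_sym (@adj_sym star_graph)).
Qed.

Lemma kappa_star_graph (S : {set star_graph}) : 1 < #|S| -> kappa S <= 1.
Proof.
move=> S2; apply/bigmax_leqP => F /andP[/forall_inP FT /forall_inP FD].
(* Of two distinct vertices of [S], at most one is the centre 0. *)
have [x xS x0] : exists2 x : star_graph, x \in S & x != 0 :> nat.
  have /card_gt1P[x [y [xS yS xy]]] := S2.
  have [x0|] := eqVneq (x : nat) 0; last by exists x.
  exists y => //; apply: contra xy => /eqP y0.
  by apply/eqP/val_inj; rewrite /= x0 y0.
have leaf (y z : star_graph) : adj x y -> adj x z -> y = z.
  move=> /andP[_ xy] /andP[_ xz]; apply: val_inj.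
  by move: xy xz; rewrite (negPf x0) => /eqP y0 /eqP z0; rewrite /= y0 z0.
apply/card_le1_eqP => H H' HF HF'; apply/eqP/contraT => nH.
have [y yH] := tree_neighbour S2 (FT H HF) xS.
have [z zH] := tree_neighbour S2 (FT H' HF') xS.
(* Both trees have an edge at the leaf [x], whose only neighbour is the centre, so they share that
   edge. *)
have [] := (tree_edge_pair (FT H HF) yH, tree_edge_pair (FT H' HF') zH).
rewrite !in_edges => -[xy _ _] [xz _ _]; rewrite -(leaf y z xy xz) in zH.
have := forall_inP (FD H HF) H' HF'; rewrite eq_sym nH => /andP[/eqP E _].
by have := in_set0 [set x; y]; rewrite -E inE yH zH.
Qed.

End StarGraph.

Theorem proposition1 (n k : nat) (hk : 3 <= k) (hkn : k <= n) :
  (forall G : sgraph, #|G| = n -> connected_graph G ->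
     1 <= gen_connectivity G k <= n - uphalf k) /\
  (exists G : sgraph,
     [/\ #|G| = n, connected_graph G & gen_connectivity G k = n - uphalf k]) /\
  (exists G : sgraph,
     [/\ #|G| = n, connected_graph G & gen_connectivity G k = 1]).
Proof.
have n0 : 0 < n by lia.
(* Subtraction being truncated, this identity relies on [k <= n]. *)
have halfE : n - k + k./2 = n - uphalf k by lia.
have bounds (G : sgraph) : #|G| = n -> connected_graph G ->
    1 <= gen_connectivity G k <= n - uphalf k.
  (* The minimum is attained at some [S], so bounds on each [kappa S] carry over to it. *)
  move=> Gn cG; have [|S Sk ->] := @gen_connectivity_min G k;
    first by rewrite Gn.
  have S2 : 1 < #|S| by rewrite Sk; lia.
  by rewrite kappa_gt0 //= -halfE -Gn -Sk kappa_le.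
split=> //; split.
- exists (complete_graph n).
  have Gn : #|complete_graph n| = n := card_ord n.
  have cG := complete_graph_connected n0.
  split=> //; apply/eqP; rewrite eqn_leq; case/andP: (bounds _ Gn cG) => _ ->.
  have [|S Sk ->] := @gen_connectivity_min (complete_graph n) k;
    first by rewrite Gn.
  by rewrite -halfE -Sk kappa_complete_graph // Sk; lia.
- exists (star_graph n).
  have Gn : #|star_graph n| = n := card_ord n.
  have cG := star_graph_connected n0.
  split=> //; apply/eqP; rewrite eqn_leq; case/andP: (bounds _ Gn cG) => -> _.
  have [|S Sk ->] := @gen_connectivity_min (star_graph n) k;
    first by rewrite Gn.
  by rewrite kappa_star_graph // Sk; lia.
Qed.
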